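(* Let $I\subseteq S$ be a monomial ideal. Then $(I^{(k)})^*=(I^* )^{(k)}$ for all $k\ge1$, where $^{(k)}$ denotes the $k$-th symbolic power.
   Context: Let $K$ be a field and $S=K[x_1,\ldots,x_n]$. Fix an $n$-tuple $(i_1,\ldots,i_n)$ of positive integers, let $S^*$ be the polynomial ring over $K$ in the variables $x_{jk}$, $1\le j\le n$, $1\le k\le i_j$, and set $P_j=(x_{j1},\ldots,x_{ji_j})\subseteq S^*$. For a monomial ideal $I\subseteq S$ generated by monomials $\mathbf{x}^{\mathbf{a}_1},\ldots,\mathbf{x}^{\mathbf{a}_m}$, with $\mathbf{a}_i=(a_i(1),\ldots,a_i(n))$, the expansion of $I$ is the monomial ideal $$I^*=\sum_{i=1}^m P_1^{a_i(1)}\cdots P_n^{a_i(n)}\subseteq S^*,$$ which does not depend on the choice of monomial generators. For a monomial ideal $I$ (in any polynomial ring) with set of minimal prime ideals $\operatorname{Min}(I)=\{\mathfrak{p}_1,\ldots,\mathfrak{p}_r\}$ and $k\ge1$, the $k$-th symbolic power is $I^{(k)}=Q_1\cap\cdots\cap Q_r$, where $Q_i$ is the $\mathfrak{p}_i$-primary component of $I^k$. *)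

(* Defs.v *)
From HB Require Import structures.
From mathcomp Require Import all_boot all_order all_algebra.
From mathcomp Require Import boolp classical_sets mpoly.

Set Implicit Arguments.
Unset Strict Implicit.
Unset Printing Implicit Defensive.

Import GRing.Theory.

Local Open Scope classical_set_scope.
Local Open Scope ring_scope.

Section Ideals.
Variable R : comNzRingType.
Implicit Types I J Q p q : set R.

(* The ideals of ring_quotient (idealr_closed, prime_idealr_closed) are boolean
   predicates and proper; here ideals are arbitrary, possibly non-proper sets. *)
Definition is_ideal I : Prop :=
  [/\ I 0, forall u v, I u -> I v -> I (u + v) & forall a u, I u -> I (a * u)].

Definition ideal_gen (G : set R) : set R := smallest is_ideal G.

Definition ideal_mul I J : set R :=
  ideal_gen [set h | exists f g, [/\ I f, J g & h = f * g]].

Definition ideal_exp I (k : nat) : set R := iter k (ideal_mul I) setT.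

Definition radical I : set R := [set f | exists m : nat, I (f ^+ m)].

Definition prime_ideal p : Prop :=
  [/\ is_ideal p, ~ p 1 & forall u v, p (u * v) -> p u \/ p v].

Definition primary_ideal Q : Prop :=
  [/\ is_ideal Q, ~ Q 1 & forall u v, Q (u * v) -> Q u \/ radical Q v].

Definition minimal_primes I : set (set R) :=
  [set p | [/\ prime_ideal p, I `<=` p &
     forall q, prime_ideal q -> I `<=` q -> q `<=` p -> q = p]].

Definition minimal_primary_decomposition J (r : nat) (D : 'I_r -> set R) : Prop :=
  [/\ forall l, primary_ideal (D l),
      J = \bigcap_(l in [set: 'I_r]) D l,
      injective (fun l => radical (D l)) &
      forall l, ~ (\bigcap_(l' in [set l' | l' != l]) D l' `<=` D l)].

(* The p-primary components of J in its minimal primary decompositions; for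
   p minimal over J there is exactly one by the second uniqueness theorem. *)
Definition primary_component J p : set (set R) :=
  [set Q | exists (r : nat) (D : 'I_r -> set R) (l : 'I_r),
     [/\ minimal_primary_decomposition J D, radical (D l) = p & Q = D l]].

(* The empty intersection, for I = R, is R. *)
Definition symbolic_power I (k : nat) : set R :=
  \bigcap_(p in minimal_primes I)
    \bigcap_(Q in primary_component (ideal_exp I k) p) Q.

End Ideals.

Section MonomialIdeals.
Variables (K : fieldType) (n : nat).

Definition monomial_gen (s : seq 'X_{1..n}) : set {mpoly K[n]} :=
  ideal_gen [set f | exists2 a, a \in s & f = 'X_[a]].

Definition monomial_ideal (I : set {mpoly K[n]}) : Prop :=
  exists s, I = monomial_gen s.

End MonomialIdeals.

Arguments monomial_gen K {n} s.

Section Expansion.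
Variables (K : fieldType) (n : nat) (i : 'I_n -> nat).

(* The pairs (j, k) with k < i j index the variables x_{jk} of S^*. *)
Definition xindex := {j : 'I_n & 'I_(i j)}.

Definition nxvars : nat := #|{: xindex}|.

Definition xvar (j : 'I_n) (k : 'I_(i j)) : {mpoly K[nxvars]} :=
  'X_(enum_rank (Tagged (fun j => 'I_(i j)) k : xindex)).

Definition Pideal (j : 'I_n) : set {mpoly K[nxvars]} :=
  ideal_gen (range (@xvar j)).

Definition Pprod (a : 'X_{1..n}) : set {mpoly K[nxvars]} :=
  \big[@ideal_mul _/setT]_(j < n) ideal_exp (Pideal j) (a j).

(* A sum of ideals is the ideal generated by their union. *)
Definition expansion_gen (s : seq 'X_{1..n}) : set {mpoly K[nxvars]} :=
  ideal_gen (\bigcup_(a in [set` s]) Pprod a).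

(* The union runs over all the finite monomial generating families of I, which
   all give the same ideal by [expansionE] below; it is empty (hence not even
   an ideal) when I is not a monomial ideal. *)
Definition expansion (I : set {mpoly K[n]}) : set {mpoly K[nxvars]} :=
  \bigcup_(s in [set s | I = monomial_gen K s]) expansion_gen s.

End Expansion.

Arguments expansion {K n} i I.
Arguments Pprod K {n} i a.
Arguments expansion_gen K {n} i s.

Lemma is_ideal_gen (R : comNzRingType) (G : set R) : is_ideal (ideal_gen G).
Proof.
split=> [J [[J0 _ _] _] //|u v Gu Gv J JP|a u Gu J JP].
  by case: (JP) => -[_ JD _] _; apply: JD; [apply: Gu|apply: Gv].
by case: (JP) => -[_ _ JM] _; apply: JM; apply: Gu.
Qed.

Lemma is_idealT (R : comNzRingType) : is_ideal [set: R].
Proof. by []. Qed.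

Lemma ideal_mulSS (R : comNzRingType) (I I' J J' : set R) :
  I `<=` I' -> J `<=` J' -> ideal_mul I J `<=` ideal_mul I' J'.
Proof.
move=> sI sJ; apply: sub_smallest2r; first exact: is_ideal_gen.
by move=> h [f [g [If Jg ->]]]; exists f, g; split; [exact: sI|exact: sJ|].
Qed.

Lemma is_ideal_exp (R : comNzRingType) (I : set R) k : is_ideal (ideal_exp I k).
Proof. by case: k => [|k]; [exact: is_idealT|exact: is_ideal_gen]. Qed.

Lemma ideal_exp_leq (R : comNzRingType) (I : set R) k l :
  (k <= l)%N -> ideal_exp I l `<=` ideal_exp I k.
Proof.
move=> /subnK <-; elim: (l - k)%N => [//|d IHd].
apply: subset_trans IHd; rewrite addSn /=.
apply: smallest_sub; first exact: is_ideal_exp.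
move=> h [f [g [_ Ig ->]]].
by have [_ _ IM] := is_ideal_exp I (d + k); apply: IM.
Qed.

Lemma Pprod_leq (K : fieldType) n (i : 'I_n -> nat) (a b : 'X_{1..n}) :
  (a <= b)%MM -> Pprod K i b `<=` Pprod K i a.
Proof.
move=> /mnm_lepP leab; rewrite /Pprod.
apply: (big_ind2 (fun I J : set {mpoly K[nxvars i]} => J `<=` I)) => //.
- by move=> I I' J J' sI sJ; apply: ideal_mulSS.
- by move=> j _; apply: ideal_exp_leq.
Qed.

Lemma monomial_genP (K : fieldType) n (s : seq 'X_{1..n}) (f : {mpoly K[n]}) :
  monomial_gen K s f -> forall m, m \in msupp f -> exists2 a, a \in s & (a <= m)%MM.
Proof.
pose J := [set f : {mpoly K[n]} |
  forall m, m \in msupp f -> exists2 a, a \in s & (a <= m)%MM].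
suff : monomial_gen K s `<=` J by apply.
apply: smallest_sub; last first.
  by move=> _ [a sa ->] m; rewrite msuppX inE => /eqP ->; exists a; rewrite ?lepm_refl.
split=> [m|u v Ju Jv m /msuppD_le|c u Ju m /msuppM_le].
- by rewrite msupp0.
- by rewrite mem_cat => /orP[/Ju|/Jv].
- case/allpairsP=> -[m1 m2] /= [_ /Ju [a sa am2] ->]; exists a => //.
  by apply: lepm_trans am2 _; rewrite lem_addl.
Qed.

Lemma expansionE (K : fieldType) n (i : 'I_n -> nat) (s : seq 'X_{1..n}) :
  expansion i (monomial_gen K s) = expansion_gen K i s.
Proof.
apply/seteqP; split=> [f [t /= eqst]|f fs]; last by exists s.
apply: smallest_sub; first exact: is_ideal_gen.
move=> g [b tb bg].
have: monomial_gen K s 'X_[b].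
  by rewrite eqst; apply: sub_gen_smallest; exists b.
move=> /monomial_genP /(_ b); rewrite msuppX inE eqxx => /(_ isT) [a sa leab].
by apply: sub_gen_smallest; exists a => //; apply: Pprod_leq leab _ bg.
Qed.

(* Main.v *)
(* A monomial ideal is the set of polynomials whose monomials all lie in some
   up-set A of exponent vectors. Its minimal primes are the P_F = (x_j : j in F)
   for the minimal sets F meeting the supports of all elements of A. For p
   minimal over a monomial ideal J, the p-primary component of J is
   {f | g f in J for some g outside p}, and for p = P_F this amounts to forgetting
   the exponents outside F. So the symbolic powers of I are given by a
   combinatorial recipe on A. Expansion is the preimage of A under the map of
   exponent vectors that sums the exponents of each block x_{j1}, ..., x_{ji_j};
   this map lifts inequalities and decompositions into sums, hence commutes with
   powers, with forgetting exponents and with minimal covers. *)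
Require Import Defs.
From mathcomp Require Import all_boot all_order all_algebra.
From mathcomp Require Import boolp classical_sets mpoly.
From mathcomp Require Import zify ring.

Set Implicit Arguments.
Unset Strict Implicit.
Unset Printing Implicit Defensive.

Import GRing.Theory.

Local Open Scope classical_set_scope.
Local Open Scope ring_scope.

(** * Primary components at minimal primes, in an arbitrary commutative ring *)

Section PrimaryDecomposition.
Variable R : comNzRingType.
Implicit Types I J Q p : set R.

(** For [p] prime, this is the contraction to [R] of the localization of [J] at [p]. *)
Definition saturation J p : set R := [set f | exists2 g, ~ p g & J (g * f)].

Lemma ideal_sum I (T : eqType) (r : seq T) (F : T -> R) :
  is_ideal I -> (forall t, t \in r -> I (F t)) -> I (\sum_(t <- r) F t).
Proof.
move=> [I0 ID _] IF; rewrite big_seq; elim/big_ind: _ => //.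
Qed.

Lemma ideal_setI I J : is_ideal I -> is_ideal J -> is_ideal (I `&` J).
Proof.
move=> [I0 ID IM] [J0 JD JM]; split=> [//|u v [Iu Ju] [Iv Jv]|a u [Iu Ju]].
  by split; [apply: ID|apply: JD].
by split; [apply: IM|apply: JM].
Qed.

Lemma ideal_exprS I u m k : is_ideal I -> (m <= k)%N -> I (u ^+ m) -> I (u ^+ k).
Proof. by move=> [_ _ IM] /subnK <- Iu; rewrite exprD; apply: IM. Qed.

Lemma ideal_radical I : is_ideal I -> is_ideal (radical I).
Proof.
move=> II; have [I0 ID IM] := II; split; first by exists 1%N; rewrite expr1.
  move=> u v [a Iu] [b Iv]; exists (a + b)%N; rewrite exprDn.
  apply: ideal_sum => // -[c /= _] _; rewrite -mulr_natl; apply: (IM).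
  have [le_bc|lt_cb] := leqP b c; first by apply: (IM); apply: ideal_exprS Iv.
  by rewrite mulrC; apply: (IM); apply: ideal_exprS Iu => //; rewrite -addnBA ?leq_addr // ltnW.
by move=> a u [m Iu]; exists m; rewrite exprMn; apply: IM.
Qed.

Lemma sub_radical I : I `<=` radical I.
Proof. by move=> u Iu; exists 1%N; rewrite expr1. Qed.

Lemma prime_radical_sub I p : prime_ideal p -> I `<=` p -> radical I `<=` p.
Proof.
move=> [_ p1 pM] sIp u [m /sIp]; elim: m => [|m IHm]; first by rewrite expr0.
by rewrite exprS => /pM[].
Qed.

Lemma radical_primary_prime Q : primary_ideal Q -> prime_ideal (radical Q).
Proof.
move=> [IQ Q1 QM]; split; [exact: ideal_radical|by move=> [m]; rewrite expr1n|].
move=> u v [m]; rewrite exprMn => /QM[Qu|[k Qv]]; first by left; exists m.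
by right; exists (m * k)%N; rewrite exprM.
Qed.

Lemma radicalI I J : is_ideal I -> is_ideal J ->
  radical (I `&` J) = radical I `&` radical J.
Proof.
move=> II JJ; apply/seteqP; split=> [u [m [Iu Ju]]|u [[a Iu] [b Ju]]].
  by split; exists m.
exists (maxn a b); split; first by apply: ideal_exprS Iu; rewrite ?leq_maxl.
by apply: ideal_exprS Ju; rewrite ?leq_maxr.
Qed.

Lemma primary_setI Q Q' : primary_ideal Q -> primary_ideal Q' ->
  radical Q = radical Q' -> primary_ideal (Q `&` Q').
Proof.
move=> [IQ Q1 QM] [IQ' Q1' QM'] eqr; split; [exact: ideal_setI|by case|].
move=> u v [Quv Quv']; rewrite radicalI // -eqr setIid.
have [Qu|//] := QM _ _ Quv; last by right.
have [Qu'|] := QM' _ _ Quv'; first by left.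
by rewrite -eqr; right.
Qed.

Lemma bigcap_lift (r : nat) (D : 'I_r.+1 -> set R) l :
  \bigcap_(i in [set: 'I_r.+1]) D i
    = D l `&` \bigcap_(i in [set: 'I_r]) D (lift l i).
Proof.
apply/seteqP; split=> [u Du|u [Dlu Du] i _].
  by split=> [|i _]; apply: Du.
by case: (unliftP l i) => [j ->|->]; [apply: Du|].
Qed.

(* A primary decomposition with the least number of components is minimal: two
   components with the same radical could be merged. *)
Lemma minimal_primary_decomposition_exists J (r : nat) (D : 'I_r -> set R) :
    (forall l, primary_ideal (D l)) -> J = \bigcap_(l in [set: 'I_r]) D l ->
  exists r' (D' : 'I_r' -> set R), minimal_primary_decomposition J D'.
Proof.
move=> prD JD.
pose P r' := `[< exists D' : 'I_r' -> set R, (forall l, primary_ideal (D' l)) /\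
                   J = \bigcap_(l in [set: 'I_r']) D' l >].
have exP : exists r', P r' by exists r; apply/asboolP; exists D.
case: (ex_minnP exP) => {prD JD} {}r /asboolP [{}D [prD JD]] rmin.
exists r, D; case: r D prD JD rmin => [|r] D prD JD rmin.
  by split=> // -[].
have short (D' : 'I_r -> set R) : (forall l, primary_ideal (D' l)) ->
    J = \bigcap_(l in [set: 'I_r]) D' l -> False.
  move=> prD' JD'; have /rmin : P r by apply/asboolP; exists D'.
  by rewrite ltnn.
split=> // [l l' /= eqr|l sD].
- case: (unliftP l l') => [j l'E|->//]; exfalso.
  apply: (short (fun i => if i == j then D l `&` D l' else D (lift l i))).
    by move=> i; case: eqP => _ //; apply: primary_setI.
  rewrite JD (bigcap_lift _ l); apply/seteqP; split=> [u [Dlu Du] i _|u Du].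
    case: eqP => _; last exact: Du.
    by split=> //; rewrite l'E; apply: Du.
  split=> [|i _]; first by have := Du j I; rewrite eqxx => -[].
  by have := Du i I; case: eqP => [-> []|//]; rewrite l'E.
- apply: (short (fun i => D (lift l i))) => //.
  rewrite JD (bigcap_lift _ l); apply/seteqP; split=> [u []//|u Du]; split=> //.
  apply: sD => i /=; case: (unliftP l i) => [j -> _|->]; first exact: Du.
  by rewrite eqxx.
Qed.

(** The product of one element outside [p] from each ideal is still outside [p], by primality, and
    lies in all of them. *)
Lemma prime_bigcap p (r : nat) (D : 'I_r -> set R) (P : set 'I_r) :
    prime_ideal p -> (forall l, P l -> is_ideal (D l)) ->
    (forall l, P l -> exists2 g, D l g & ~ p g) ->
  exists2 g, (\bigcap_(l in P) D l) g & ~ p g.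
Proof.
move=> [_ p1 pM] ID exg.
have /choice [g gP] : forall l, exists g, ~ p g /\ (P l -> D l g).
  (* Indices outside [P] contribute the harmless factor 1. *)
  move=> l; have [/exg [g Dg pg]|nP] := pselect (P l); first by exists g.
  by exists 1.
exists (\prod_l g l); last first.
  by elim/big_ind: _ => // [u v pu pv /pM[]//|l _]; case: (gP l).
move=> l Pl; rewrite (bigD1 l) //= mulrC.
by have [_ _ IM] := ID l Pl; apply: IM; case: (gP l) => _; apply.
Qed.

Lemma minimal_prime_sub I p q : minimal_primes I p -> prime_ideal q ->
  I `<=` q -> q `<=` p -> q = p.
Proof. by case=> _ _; apply. Qed.

(** If [g * f] is in [J] with [g] outside [p], the radical of the component, then primariness puts
    [f] in the component. Conversely, no other component lies in [p], so some [g] outside [p] lies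
    in all of them and multiplies [Q] into [J]. In particular the component is unique. *)
Lemma primary_component_saturation J p Q :
  minimal_primes J p -> primary_component J p Q -> Q = saturation J p.
Proof.
move=> pmin [r [D [l [[prD JD injD _] rD ->]]]].
have [pp Jp _] := pmin.
have [IQ Q1 QM] := prD l.
apply/seteqP; split=> [f Df|f [g pg Jgf]]; last first.
  have : D l (f * g) by move: Jgf; rewrite JD mulrC => /(_ l I).
  by move=> /QM[//|]; rewrite rD.
have [] := @prime_bigcap p r D [set l' | l' != l] pp.
- by move=> l' _; case: (prD l').
(* A component inside [p] has as radical a prime between [J] and [p], so [p] itself by minimality;
   but the radicals are distinct. *)
- move=> l' /= ll'; apply: contrapT => /forall2NP nex.
  have sDp : D l' `<=` p by move=> g Dg; case: (nex g) => // /contrapT.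
  suff /injD e : radical (D l') = radical (D l) by rewrite e eqxx in ll'.
  rewrite rD; apply: (minimal_prime_sub pmin).
  + exact: radical_primary_prime.
  + by rewrite JD => u Ju; apply/sub_radical/Ju.
  + exact: prime_radical_sub.
- move=> g Dg pg; exists g => //; rewrite JD => l' _.
  have [->|ll'] := eqVneq l' l; first by have [_ _ IM] := IQ; apply: IM.
  by rewrite mulrC; have [[_ _ IM] _ _] := prD l'; apply: IM; apply: Dg.
Qed.

(** The prime [p] contains the intersection of the components, hence one of them; minimality of [p]
    then makes [p] its radical. *)
Lemma primary_component_exists J p (r : nat) (D : 'I_r -> set R) :
    (forall l, primary_ideal (D l)) -> J = \bigcap_(l in [set: 'I_r]) D l ->
    minimal_primes J p ->
  exists Q, primary_component J p Q.
Proof.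
move=> prD JD pmin; have [pp Jp _] := pmin.
have [r' [D' minD']] := minimal_primary_decomposition_exists prD JD.
have [prD' JD' _ _] := minD'.
suff [l sDp] : exists l, D' l `<=` p.
  exists (D' l), r', D', l; split => //.
  apply: (minimal_prime_sub pmin).
  - exact: radical_primary_prime.
  - by rewrite JD' => u Ju; apply/sub_radical/Ju.
  - exact: prime_radical_sub.
apply: contrapT => /forallNP nex.
have [] := @prime_bigcap p r' D' setT pp.
- by move=> l _; case: (prD' l).
- move=> l _; apply: contrapT => /forall2NP nexg; apply: (nex l) => g Dg.
  by case: (nexg g) => // /contrapT.
- by rewrite -JD' => g /Jp.
Qed.

(** A prime contains the [k]-th power of [I] exactly when it contains [I], because the power
    contains every [f ^+ k] with [f] in [I]. *)
Lemma minimal_primes_exp I k : is_ideal I -> (0 < k)%N ->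
  minimal_primes (ideal_exp I k) = minimal_primes I.
Proof.
move=> II k0.
have powI f m : I f -> ideal_exp I m (f ^+ m).
  move=> If; elim: m => [//|m IHm].
  by apply: sub_gen_smallest; exists f, (f ^+ m); rewrite -exprS.
have sIk : ideal_exp I k `<=` I.
  apply: subset_trans (ideal_exp_leq (I := I) k0) _.
  apply: smallest_sub => // h [f [g [If _ ->]]].
  by rewrite mulrC; have [_ _ IM] := II; apply: IM.
have contE q : prime_ideal q -> (ideal_exp I k `<=` q) = (I `<=` q).
  move=> qp; apply/propext; split=> [sIq f If|]; last exact: subset_trans.
  by apply: (prime_radical_sub qp sIq); exists k; apply: powI.
apply/seteqP; split=> p [pp]; rewrite ?contE // => sp pmin; split; rewrite ?contE //.
  by move=> q qp; rewrite -contE //; apply: pmin.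
by move=> q qp; rewrite contE //; apply: pmin.
Qed.

End PrimaryDecomposition.

(** * Combinatorics of up-sets of exponent vectors *)

Section UpSets.
Variable n : nat.
Implicit Types (A B : set 'X_{1..n}) (F G : set 'I_n) (a b m : 'X_{1..n}).

Definition upset A := forall a m, A a -> (a <= m)%MM -> A m.

Definition upset_add A B : set 'X_{1..n} :=
  [set m | exists a b, [/\ A a, B b & m = (a + b)%MM]].

Definition upset_exp A k : set 'X_{1..n} := iter k (upset_add A) setT.

(* The exponents of [A] after setting [x_j := 1] for all [j] outside [F]. *)
Definition localize A F : set 'X_{1..n} :=
  [set m | exists2 a, A a & forall j, F j -> (a j <= m j)%N].

(* The exponents of the prime ideal [P_F] generated by the [x_j] with [j] in [F]. *)
Definition support_meets F : set 'X_{1..n} := [set m | exists2 j, F j & (0 < m j)%N].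

Definition minimal_cover A F :=
  A `<=` support_meets F /\ forall G, A `<=` support_meets G -> G `<=` F -> G = F.

(** Finite generation as a bound on the exponents of the generators: such a bound passes through
    sums, localizations, intersections and pullbacks without naming any generator. *)
Definition generated_below (d : nat) A :=
  forall m, A m -> exists a, [/\ A a, (a <= m)%MM & forall j, (a j <= d)%N].

Definition up_closure (s : seq 'X_{1..n}) : set 'X_{1..n} :=
  [set m | exists2 a, a \in s & (a <= m)%MM].

Definition mrestr F m : 'X_{1..n} := [multinom if `[< F j >] then m j else 0%N | j < n].

Lemma mrestrE F m j : mrestr F m j = if `[< F j >] then m j else 0%N.
Proof. by rewrite mnmE. Qed.

Lemma upset_addP A B : upset A -> upset (upset_add A B).
Proof.
move=> uA _ m [a [b [Aa Bb ->]]] abm; exists (m - b)%MM, b; split => //.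
  apply: uA Aa _; apply/mnm_lepP => j; move/mnm_lepP/(_ j): abm.
  by rewrite mnmDE mnmBE; lia.
apply/mnmP => j; move/mnm_lepP/(_ j): abm.
by rewrite !mnmDE mnmBE; lia.
Qed.

Lemma upset_expP A k : upset A -> upset (upset_exp A k).
Proof. by case: k => [|k] // uA; apply: upset_addP. Qed.

Lemma upset_localize A F : upset (localize A F).
Proof.
move=> a m [b Ab ba] /mnm_lepP am; exists b => // j Fj.
exact: leq_trans (ba j Fj) (am j).
Qed.

Lemma upset_support_meets F : upset (support_meets F).
Proof. by move=> a m [j Fj aj] /mnm_lepP am; exists j => //; apply: leq_trans (am j). Qed.

Lemma upset_up_closure s : upset (up_closure s).
Proof. by move=> a m [b sb ba] am; exists b => //; apply: lepm_trans am. Qed.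

Lemma upsetU A B : upset A -> upset B -> upset (A `|` B).
Proof. by move=> uA uB a m [/uA|/uB] H /H; [left|right]. Qed.

Lemma sub_localize A F : A `<=` localize A F.
Proof. by move=> m Am; exists m. Qed.

Lemma generated_below_add d e A B : generated_below d A -> generated_below e B ->
  generated_below (d + e) (upset_add A B).
Proof.
move=> gA gB _ [a [b [/gA[a' [Aa' /mnm_lepP a'a a'd]] /gB[b' [Bb' /mnm_lepP b'b b'd]] ->]]].
exists (a' + b')%MM; split; first by exists a', b'.
  by apply/mnm_lepP => j; rewrite !mnmDE leq_add.
by move=> j; rewrite mnmDE leq_add.
Qed.

Lemma generated_below_exp d A k :
  generated_below d A -> generated_below (k * d) (upset_exp A k).
Proof.
move=> gA; elim: k => [m _|k IHk]; last exact: generated_below_add.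
exists 0%MM; split => //; last by move=> j; rewrite mnm0E.
by apply/mnm_lepP => j; rewrite mnm0E.
Qed.

Lemma generated_below_localize d A F :
  generated_below d A -> generated_below d (localize A F).
Proof.
move=> gA m [b Ab bm]; have [a [Aa /mnm_lepP ab ad]] := gA _ Ab; exists (mrestr F a); split.
- by exists a => // j Fj; rewrite mrestrE; case: asboolP.
- apply/mnm_lepP => j; rewrite mrestrE; case: asboolP => // Fj.
  exact: leq_trans (bm j Fj).
- by move=> j; rewrite mrestrE; case: ifP.
Qed.

Definition trunc d m : 'X_{1..n} := [multinom minn (m j) d | j < n].

Lemma trunc_le d m : (trunc d m <= m)%MM.
Proof. by apply/mnm_lepP => j; rewrite mnmE geq_minl. Qed.

(** A generator below [m] with entries at most [d] is also below the truncation. As [trunc d m] does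
    not depend on [A], one truncation serves a whole family of up-sets, which gives the bound for
    intersections. *)
Lemma trunc_mem d A m : upset A -> generated_below d A -> A m -> A (trunc d m).
Proof.
move=> uA gA /gA[a [Aa /mnm_lepP am ad]]; apply: uA Aa _.
by apply/mnm_lepP => j; rewrite mnmE leq_min am ad.
Qed.

Lemma generated_below_bigcap d (T : Type) (P : set T) (A : T -> set 'X_{1..n}) :
    (forall t, P t -> upset (A t)) -> (forall t, P t -> generated_below d (A t)) ->
  generated_below d (\bigcap_(t in P) A t).
Proof.
move=> uA gA m Am; exists (trunc d m); split; last 2 first.
- exact: trunc_le.
- by move=> j; rewrite mnmE geq_minr.
by move=> t Pt; apply: trunc_mem (uA t Pt) (gA t Pt) (Am t Pt).
Qed.

Lemma generated_below_up_closure s : exists d, generated_below d (up_closure s).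
Proof.
exists (\max_(a <- s) \max_j a j)%N => m [a sa am]; exists a; split => //.
  by exists a; rewrite ?lepm_refl.
move=> j; apply: leq_trans (leq_bigmax_seq _ sa isT).
exact: leq_bigmax.
Qed.

Definition mbox d : seq 'X_{1..n} :=
  [seq [multinom nat_of_ord (f j) | j < n] | f : {ffun 'I_n -> 'I_d.+1}].

Lemma mem_mbox d m : (forall j, m j <= d)%N -> m \in mbox d.
Proof.
move=> md; apply/fintype.imageP; exists [ffun j => inord (m j)] => //.
by apply/mnmP => j; rewrite mnmE ffunE inordK // ltnS.
Qed.

(** Turns the bound into an explicit finite list of generators, the form in which monomial ideals
    and expansions are defined. *)
Lemma up_closure_mbox d A : upset A -> generated_below d A ->
  A = up_closure [seq a <- mbox d | `[< A a >]].
Proof.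
move=> uA gA; apply/seteqP; split=> m; last first.
  by move=> [a]; rewrite mem_filter => /andP[/asboolP Aa _]; apply: uA.
move=> /gA[a [Aa am ad]]; exists a => //; rewrite mem_filter mem_mbox // andbT.
exact/asboolP.
Qed.

End UpSets.

(** * The dictionary between up-sets and monomial ideals *)

Section MonomialIdealsOfUpSets.
Variables (K : fieldType) (n : nat).
Implicit Types (A B : set 'X_{1..n}) (F G : set 'I_n) (a b m : 'X_{1..n}).
Implicit Types (I p : set {mpoly K[n]}) (u v : {mpoly K[n]}).

Definition mideal A : set {mpoly K[n]} := [set f | forall m, m \in msupp f -> A m].

Lemma ideal_mideal A : upset A -> is_ideal (mideal A).
Proof.
move=> uA; split=> [m|u v Iu Iv m /msuppD_le|a u Iu m /msuppM_le].
- by rewrite msupp0.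
- by rewrite mem_cat => /orP[/Iu|/Iv].
- by case/allpairsP=> -[m1 m2] /= [_ /Iu Am2 ->]; apply: uA Am2 (lem_addl _ _).
Qed.

Lemma mideal_sub A I : is_ideal I -> (forall m, A m -> I 'X_[m]) -> mideal A `<=` I.
Proof.
move=> II AI f Af; rewrite [f]mpolyE; apply: ideal_sum => // m /Af/AI Im.
by rewrite -mul_mpolyC; have [_ _ IM] := II; apply: IM.
Qed.

Lemma mideal_mpolyX A m : mideal A 'X_[m] <-> A m.
Proof.
split=> [|Am m']; first by apply; rewrite msuppX inE.
by rewrite msuppX inE => /eqP ->.
Qed.

Lemma midealS A B : A `<=` B -> mideal A `<=` mideal B.
Proof. by move=> AB f Af m /Af/AB. Qed.

Lemma mideal_up_closure (s : seq 'X_{1..n}) : mideal (up_closure s) = monomial_gen K s.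
Proof.
apply/seteqP; split; last by move=> f /monomial_genP.
apply: mideal_sub => [|m [a sa am]]; first exact: is_ideal_gen.
rewrite -(submK am) mpolyXD; have [_ _ IM] := is_ideal_gen [set f : {mpoly K[n]} |
  exists2 a, a \in s & f = 'X_[a]].
by apply: IM; apply: sub_gen_smallest; exists a.
Qed.

Lemma mideal_mul A B : upset A ->
  ideal_mul (mideal A) (mideal B) = mideal (upset_add A B).
Proof.
move=> uA; apply/seteqP; split.
  apply: smallest_sub; first exact/ideal_mideal/upset_addP.
  move=> _ [f [g [Af Bg ->]]] m /msuppM_le/allpairsP[[a b] /= [/Af Aa /Bg Bb ->]].
  by exists a, b.
apply: mideal_sub; first exact: is_ideal_gen.
move=> _ [a [b [Aa Bb ->]]]; rewrite mpolyXD; apply: sub_gen_smallest.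
by exists 'X_[a], 'X_[b]; split => //; apply/mideal_mpolyX.
Qed.

Lemma mideal_exp A k : upset A -> ideal_exp (mideal A) k = mideal (upset_exp A k).
Proof.
move=> uA; elim: k => [|k IHk]; first by apply/seteqP.
by rewrite /ideal_exp /= -/(ideal_exp _ k) IHk mideal_mul.
Qed.

Lemma mideal_bigcap (T : Type) (P : set T) (A : T -> set 'X_{1..n}) :
  \bigcap_(t in P) mideal (A t) = mideal (\bigcap_(t in P) A t).
Proof.
apply/seteqP; split=> [f Af m mf t Pt|f Af t Pt m /Af]; last exact.
exact: Af.
Qed.

Lemma mproj_split A u : exists u1 u2,
  [/\ u = u1 + u2, {in msupp u1, forall m, m \in msupp u /\ A m} &
      {in msupp u2, forall m, m \in msupp u /\ ~ A m}].
Proof.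
exists (\sum_(m <- msupp u | `[< A m >]) u@_m *: 'X_[m]).
exists (\sum_(m <- msupp u | ~~ `[< A m >]) u@_m *: 'X_[m]).
have H (P : pred 'X_{1..n}) : {in msupp (\sum_(m <- msupp u | P m) u@_m *: 'X_[m]),
    forall m, m \in msupp u /\ P m}.
  move=> m /msupp_sum_le/flatten_mapP[m'].
  rewrite mem_filter => /andP[Pm' um'] /msuppZ_le.
  by rewrite msuppX inE => /eqP ->.
split; first by rewrite {1}[u]mpolyE (bigID (fun m => `[< A m >])).
  by move=> m /H[um /asboolP].
by move=> m /H[um /asboolP].
Qed.

(* Let [w] be the least F-weight of a monomial of [u] outside [A]. The product of
   the parts of [u] (outside [A]) and [v] of F-weights [w] and [0] is nonzero, and
   its monomials, outside [A] and of weight [w], cannot be cancelled in [u * v]. *)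
Lemma mideal_regular A F u v :
    upset A -> (forall m, A m -> A (mrestr F m)) ->
  mideal A (u * v) -> ~ mideal (support_meets F) v -> mideal A u.
Proof.
move=> uA AF Auv nPv.
pose wt m := mdeg (mrestr F m).
have wtD m1 m2 : wt (m1 + m2)%MM = (wt m1 + wt m2)%N.
  rewrite -mdegD; congr mdeg; apply/mnmP => j.
  by rewrite mnmDE !mrestrE mnmDE; case: ifP.
have wt0 m : wt m = 0%N <-> ~ support_meets F m.
  split.
    move=> /eqP; rewrite mdeg_eq0 => /eqP m0 [j Fj].
    by move/mnmP/(_ j): m0; rewrite mrestrE mnm0E; case: asboolP => // _ ->.
  move=> nm; apply/eqP; rewrite mdeg_eq0; apply/eqP/mnmP => j.
  rewrite mrestrE mnm0E; case: asboolP => // Fj; apply/eqP; rewrite -leqn0 leqNgt.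
  by apply/negP => mj; apply: nm; exists j.
suff H w : forall m, m \in msupp u -> wt m = w -> A m by move=> m um; apply: (H (wt m)).
elim/ltn_ind: w => w IHw m0 um0 wm0; apply: contrapT => nAm0.
(* Working modulo [B] leaves from [u] only its terms of weight exactly [w] outside [A]: heavier
   terms are in [B], lighter ones in [A] by induction. *)
pose B := A `|` [set m | (w < wt m)%N].
have uB : upset B.
  apply: upsetU => // a m /= wa /submK <-; rewrite wtD.
  exact: leq_trans wa (leq_addl _ _).
have IB := ideal_mideal uB.
have [u' [u0 [uE Bu' nBu0]]] := mproj_split B u.
have [v' [v0 [vE Fv' nFv0]]] := mproj_split (support_meets F) v.
have Bu : mideal B u' by move=> m /Bu'[].
have wtu0 m : m \in msupp u0 -> wt m = w /\ ~ A m.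
  move=> /nBu0[um nBm]; split; last by move=> Am; apply: nBm; left.
  have: ~ (w < wt m)%N by move=> wm; apply: nBm; right.
  move=> /negP; rewrite -leqNgt leq_eqVlt => /orP[/eqP //|lt_mw].
  by case: nBm; left; apply: IHw um erefl.
have Bu0v' : mideal B (u0 * v').
  move=> m /msuppM_le/allpairsP[[a b] /= [/wtu0[wa _] /Fv'[_ Fb] ->]].
  right => /=; rewrite wtD wa -addn1 leq_add2l lt0n.
  by apply/eqP => /wt0.
have Bu0v0 : mideal B (u0 * v0).
  have -> : u0 * v0 = u * v + (- v * u' + -1 * (u0 * v')).
    by rewrite uE vE; ring.
  have [_ BD BM] := IB; apply: (BD); first by apply: midealS Auv => m; left.
  by apply: BD; apply: (BM).
have [u0z|v0z] : u0 = 0 \/ v0 = 0.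
- suff /eqP : u0 * v0 = 0 by rewrite mulf_eq0 => /orP[]/eqP; [left|right].
  apply/eqP; rewrite -msupp_eq0; case E: (msupp _) => [//|m s].
  have mm : m \in msupp (u0 * v0) by rewrite E mem_head.
  have /allpairsP[[a b] /= [/wtu0[wa nAa] /nFv0[_ /wt0 wb] me]] := msuppM_le mm.
  case: (Bu0v0 _ mm); last by rewrite /= me wtD wa wb addn0 ltnn.
  (* Since [b] has no exponent in [F], the restriction of [a + b] to [F] is below [a], which would
     put [a] in [A]. *)
  move=> /AF Am; case: nAa; apply: uA Am _; apply/mnm_lepP => j.
  rewrite me mrestrE mnmDE; case: asboolP => // Fj.
  suff -> : b j = 0%N by rewrite addn0.
  move: wb => /wt0 nb; apply/eqP; rewrite -leqn0 leqNgt.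
  by apply/negP => bj; apply: nb; exists j.
- suff : m0 \in msupp u' by move=> /Bu'[_ []//]; rewrite /= wm0 ltnn.
  by rewrite uE u0z addr0 in um0.
- by apply: nPv => m; rewrite vE v0z addr0 => /Fv'[].
Qed.

(** This is [mideal_regular] for the up-set of the ideal itself, membership in which depends only on
    the exponents in [F]. *)
Lemma prime_support_meets F : prime_ideal (mideal (support_meets F)).
Proof.
split; first exact/ideal_mideal/upset_support_meets.
  by rewrite -mpolyX0 => /mideal_mpolyX[j _]; rewrite mnm0E.
move=> u v Puv; have [Pv|nPv] := pselect (mideal (support_meets F) v); [by right|left].
apply: mideal_regular Puv nPv; first exact: upset_support_meets.
by move=> m [j Fj mj]; exists j => //; rewrite mrestrE; case: asboolP.
Qed.

(** Elements outside the prime are regular modulo the localized up-set, which gives one inclusion.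
    For the other, a monomial in the variables outside [F] restores the forgotten exponents. *)
Lemma saturation_mideal A F : upset A ->
  saturation (mideal A) (mideal (support_meets F)) = mideal (localize A F).
Proof.
move=> uA; have [IA ID IM] := ideal_mideal uA; have [_ P1 PM] := prime_support_meets F.
apply/seteqP; split=> [f [g Pg Agf]|].
  apply: (@mideal_regular _ F _ g) => //; first exact: upset_localize.
    move=> m [a Aa am]; exists a => // j Fj; rewrite mrestrE.
    by case: asboolP => // _; apply: am.
  by rewrite mulrC; apply: midealS Agf; apply: sub_localize.
apply: mideal_sub.
  split; first by exists 1; rewrite ?mulr0.
    move=> u v [g Pg Agu] [h Ph Ahv]; exists (g * h); first by move=> /PM[].
    rewrite mulrDr; apply: ID; last by rewrite -mulrA; apply: (IM).
    by rewrite [g * h]mulrC -mulrA; apply: IM.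
  by move=> a u [g Pg Agu]; exists g; rewrite // mulrCA; apply: IM.
move=> m [a Aa am]; exists 'X_[mrestr (~` F) a].
  move=> /mideal_mpolyX[j Fj]; rewrite mrestrE; case: asboolP => //.
rewrite -mpolyXD; apply/mideal_mpolyX; apply: uA Aa _; apply/mnm_lepP => j.
rewrite mnmDE mrestrE; case: asboolP => [_|/contrapT/am ajm]; first exact: leq_addr.
exact: ajm.
Qed.

Lemma prime_mpolyX p m : prime_ideal p -> p 'X_[m] <-> support_meets [set j | p 'X_j] m.
Proof.
move=> [[_ _ IM] p1 pM]; split.
  rewrite mpolyXE_id; elim/big_ind: _ => // [u v IHu IHv /pM[/IHu|/IHv]//|j _].
  case E: (m j) => [|k]; first by rewrite expr0.
  move=> pX; exists j; rewrite ?E //=.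
  elim: k.+1 pX => [|k' IHk]; first by rewrite expr0.
  by rewrite exprS => /pM[].
move=> [j /= pj mj]; have /submK <- : (U_(j) <= m)%MM by rewrite lep1mP -lt0n.
by rewrite mpolyXD; apply: IM.
Qed.

(** A prime containing the ideal contains a variable of each of its monomials, so the variables it
    contains form a cover and generate a smaller prime still containing the ideal. *)
Lemma minimal_primes_mideal A : upset A ->
  minimal_primes (mideal A) = [set mideal (support_meets F) | F in minimal_cover A].
Proof.
move=> uA.
have sub_support_meets F : mideal A `<=` mideal (support_meets F) <-> A `<=` support_meets F.
  split=> [sA m Am|]; last exact: midealS.
  by apply/mideal_mpolyX/sA/mideal_mpolyX.
have cov q : prime_ideal q -> mideal A `<=` q -> A `<=` support_meets [set j | q 'X_j].
  by move=> pq sA m Am; apply/prime_mpolyX => //; apply/sA/mideal_mpolyX.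
have sq q : prime_ideal q -> mideal (support_meets [set j | q 'X_j]) `<=` q.
  by move=> pq; apply: mideal_sub; [case: pq|move=> m /(prime_mpolyX m pq)].
have meets1 F j : mideal (support_meets F) 'X_j <-> F j.
  split=> [/mideal_mpolyX[j' Fj']|Fj]; last first.
    by apply/mideal_mpolyX; exists j => //; rewrite mnm1E eqxx.
  by rewrite mnm1E; case: eqP => // ->.
apply/seteqP; split=> [p [pp Ap pmin]|_ [F [AF Fmin] <-]].
  exists [set j | p 'X_j]; last first.
    apply: pmin; [exact: prime_support_meets|exact/sub_support_meets/cov|exact: sq].
  split=> [|G AG sG]; first exact: cov.
  have e : mideal (support_meets G) = p.
    apply: pmin; [exact: prime_support_meets|exact/sub_support_meets|].
    apply: subset_trans (sq _ pp); apply: midealS => m [j /sG]; by exists j.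
  by apply/seteqP; split=> // j /=; rewrite -e => /meets1.
split; [exact: prime_support_meets|exact/sub_support_meets|move=> q pq Aq qF].
apply/seteqP; split => //.
have <- : [set j | q 'X_j] = F; last exact: sq.
apply: Fmin; first exact: cov.
by move=> j /= /qF/meets1.
Qed.

(* The irreducible monomial ideal generated by the [x_j ^ (b_j + 1)] with [b_j < d]. *)
Definition irreducible_upset d b : set 'X_{1..n} :=
  [set m | exists2 j, (b j < d)%N & (b j < m j)%N].

(** With [F] the set of [j] such that [b j < d], a factor outside the prime of [F] is regular modulo
    the ideal; a factor inside it lies in the radical, each generating variable having a power in
    the ideal. *)
Lemma primary_irreducible d b : primary_ideal (mideal (irreducible_upset d b)).
Proof.
set A := irreducible_upset d b.
have uA : upset A.
  by move=> a m [j bd ba] /mnm_lepP am; exists j => //; apply: leq_trans (am j).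
have IA := ideal_mideal uA; split => //.
  by rewrite -mpolyX0 => /mideal_mpolyX[j _]; rewrite mnm0E.
move=> u v Auv.
pose F := [set j | (b j < d)%N].
have [Pv|nPv] := pselect (mideal (support_meets F) v); [right|left]; last first.
  apply: mideal_regular Auv nPv => // m [j bd bm]; exists j => //.
  by rewrite mrestrE; case: asboolP.
have [_ _ RM] := ideal_radical IA.
apply: mideal_sub Pv; first exact: ideal_radical.
move=> m [j Fj mj]; have /submK <- : (U_(j) <= m)%MM by rewrite lep1mP -lt0n.
rewrite mpolyXD; apply: RM; exists (b j).+1; rewrite mpolyXn.
by apply/mideal_mpolyX; exists j => //; rewrite mulmnE mnm1E eqxx mul1n.
Qed.

(** One irreducible ideal is taken for each [b] in the box outside [A]: a generator of [A] cannot be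
    below [b], so it exceeds [b] at some coordinate, where [b] is less than [d]. *)
Lemma mideal_primary_decomposition d A : upset A -> generated_below d A ->
  exists r (D : 'I_r -> set {mpoly K[n]}),
    (forall l, primary_ideal (D l)) /\ mideal A = \bigcap_(l in [set: 'I_r]) D l.
Proof.
move=> uA gA.
pose s := [seq b <- mbox n d | ~~ `[< A b >]].
exists (size s), (fun l => mideal (irreducible_upset d (tnth (in_tuple s) l))).
split=> [l|]; first exact: primary_irreducible.
rewrite mideal_bigcap; congr mideal; apply/seteqP; split=> [m Am l _|m mD].
  have : tnth (in_tuple s) l \in s by apply: mem_tnth.
  rewrite mem_filter => /andP[/asboolP nAb _].
  have [a [Aa /mnm_lepP am ad]] := gA _ Am.
  apply: contrapT => /forall2NP nD; apply: nAb; apply: uA Aa _.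
  apply/mnm_lepP => j; rewrite leqNgt; apply/negP => ba.
  by case: (nD j); apply; [exact: leq_trans (ad j)|exact: leq_trans (am j)].
apply: contrapT => nAm.
(* The component attached to the truncation of [m] excludes [m]: wherever the truncation is less
   than [d], it agrees with [m]. *)
have sm : trunc d m \in s.
  rewrite mem_filter mem_mbox ?andbT; last by move=> j; rewrite mnmE geq_minr.
  by apply/asboolP => At; apply: nAm; apply: uA At (trunc_le _ _).
have lt_s : (index (trunc d m) s < size s)%N by rewrite index_mem.
have [j] := mD (Ordinal lt_s) I.
by rewrite (tnth_nth 0%MM) /= nth_index // mnmE; lia.
Qed.

Definition symbolic_upset A k : set 'X_{1..n} :=
  \bigcap_(F in minimal_cover A) localize (upset_exp A k) F.

Lemma upset_symbolic A k : upset (symbolic_upset A k).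
Proof. by move=> a m Sa am F AF; apply: upset_localize am; apply: Sa. Qed.

Lemma generated_below_symbolic d A k :
  generated_below d A -> generated_below (k * d) (symbolic_upset A k).
Proof.
move=> gA; apply: generated_below_bigcap => F _; first exact: upset_localize.
exact/generated_below_localize/generated_below_exp.
Qed.

Lemma symbolic_power_mideal d A k : upset A -> generated_below d A -> (0 < k)%N ->
  symbolic_power (mideal A) k = mideal (symbolic_upset A k).
Proof.
move=> uA gA k0; have IA := ideal_mideal uA.
have [r [D [prD JD]]] := mideal_primary_decomposition (@upset_expP _ A k uA)
  (@generated_below_exp _ d A k gA).
rewrite /symbolic_upset -mideal_bigcap /symbolic_power minimal_primes_mideal //.
rewrite bigcap_image; apply: eq_bigcapr => F AF.
have pmin : minimal_primes (ideal_exp (mideal A) k) (mideal (support_meets F)).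
  by rewrite minimal_primes_exp // minimal_primes_mideal //; exists F.
rewrite -saturation_mideal; last exact: upset_expP.
rewrite -mideal_exp //.
(* Existence matters: with no component the inner intersection would be the whole ring. *)
have [Q cQ] : exists Q, primary_component (ideal_exp (mideal A) k) (mideal (support_meets F)) Q.
  by apply: primary_component_exists pmin => //; rewrite mideal_exp.
apply/seteqP; split=> [f /(_ Q cQ)|f Jf Q' cQ'].
  by rewrite (primary_component_saturation pmin cQ).
by rewrite (primary_component_saturation pmin cQ').
Qed.

End MonomialIdealsOfUpSets.

Arguments mideal K {n} A _.

(** * Summing exponents along the fibres of a map of variables *)

Section Pushforward.
Variables (N n : nat) (t : 'I_N -> 'I_n).
Implicit Types (m : 'X_{1..N}) (a b : 'X_{1..n}) (A B : set 'X_{1..n}).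
Implicit Types (F : set 'I_n) (G : set 'I_N).

(** The effect on exponents of substituting the variable [t v] for each variable [v]. *)
Definition mpush m : 'X_{1..n} := [multinom \sum_(v | t v == j) m v | j < n].

Lemma mpushE m j : mpush m j = \sum_(v | t v == j) m v.
Proof. by rewrite mnmE. Qed.

Lemma mpush0 : mpush 0%MM = 0%MM.
Proof. by apply/mnmP => j; rewrite mpushE mnm0E big1 // => v _; rewrite mnm0E. Qed.

Lemma mpushD m m' : mpush (m + m')%MM = (mpush m + mpush m')%MM.
Proof.
apply/mnmP => j; rewrite mnmDE !mpushE -big_split.
by apply: eq_bigr => v _; rewrite mnmDE.
Qed.

Lemma mpushU v : mpush U_(v)%MM = U_(t v)%MM.
Proof.
apply/mnmP => j; rewrite mpushE mnm1E big_mkcond (bigD1 v) //= big1 ?addn0 => [|w nw].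
  by rewrite mnm1E eqxx; case: eqP.
by rewrite mnm1E [v == w]eq_sym (negPf nw); case: ifP.
Qed.

Lemma leq_mpush m v : (m v <= mpush m (t v))%N.
Proof. by rewrite mpushE (bigD1 v) //= leq_addr. Qed.

Lemma mpush_le m m' : (m <= m')%MM -> (mpush m <= mpush m')%MM.
Proof. by move=> /submK <-; rewrite mpushD lem_addl. Qed.

(** Induction on the degree of [a]: remove one unit at [j] and lift the rest to some [m']. The sum
    of [m] over the fibre of [j] exceeds that of [m'], so some variable of the fibre has room for
    the unit. *)
Lemma mpush_split a m : (a <= mpush m)%MM -> exists2 m', (m' <= m)%MM & mpush m' = a.
Proof.
elim: (mdeg a) {-2}a (erefl (mdeg a)) => [|d IHd] {}a ad am.
  exists 0%MM; first by apply/mnm_lepP => v; rewrite mnm0E.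
  by rewrite mpush0; apply/esym/eqP; rewrite -mdeg_eq0 ad.
have [j aj] : exists j, (0 < a j)%N.
  apply: contrapT => /forallNP a0; move: ad; rewrite mdegE big1 // => j _.
  by apply/eqP; rewrite -leqn0 leqNgt; apply/negP/a0.
have aE : (a - U_(j) + U_(j))%MM = a by rewrite submK // lep1mP -lt0n.
have [] := IHd (a - U_(j))%MM.
- by move: ad; rewrite -{1}aE mdegD mdeg1 addn1 => -[].
- by apply: lepm_trans am; apply: lem_subr.
move=> m' /mnm_lepP m'm m'a.
have [v /eqP tv mv] : exists2 v, t v == j & (m' v < m v)%N.
  apply: contrapT => /forall2NP nv.
  have : (mpush m j <= mpush m' j)%N.
    rewrite !mpushE; apply: leq_sum => v tv; rewrite leqNgt; apply/negP => mv.
    by case: (nv v).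
  rewrite m'a mnmBE mnm1E eqxx; move/mnm_lepP/(_ j): am; lia.
exists (m' + U_(v))%MM; last by rewrite mpushD mpushU m'a tv.
apply/mnm_lepP => w; rewrite mnmDE mnm1E; case: eqP => [<-|_]; first by rewrite addn1.
by rewrite addn0.
Qed.

Definition mpull A : set 'X_{1..N} := [set m | A (mpush m)].

Lemma upset_mpull A : upset A -> upset (mpull A).
Proof. by move=> uA m m' Am mm'; apply: uA Am (mpush_le mm'). Qed.

Lemma generated_below_mpull d A :
  upset A -> generated_below d A -> generated_below d (mpull A).
Proof.
move=> uA gA m /gA[a [Aa /mpush_split[m' m'm m'a] ad]]; exists m'; split => //.
  by rewrite /mpull /= m'a.
by move=> v; apply: leq_trans (leq_mpush _ _) _; rewrite m'a.
Qed.

(** A decomposition of the pushforward of [m] lifts: [mpush_split] gives a part of [m] over the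
    first summand, and the remainder lies over the second by cancellation. *)
Lemma mpull_add A B : mpull (upset_add A B) = upset_add (mpull A) (mpull B).
Proof.
apply/seteqP; split=> m; last first.
  by move=> [a [b [Aa Bb ->]]]; exists (mpush a), (mpush b); rewrite -mpushD.
move=> [a [b [Aa Bb mE]]].
have [|m' m'm m'a] := @mpush_split a m; first by rewrite mE lem_addr.
exists m', (m - m')%MM; split; [by rewrite /mpull /= m'a| |by rewrite addmC submK].
rewrite /mpull /=; suff -> : mpush (m - m')%MM = b by [].
by apply: (@addmI _ a); rewrite -mE -{1}m'a -mpushD addmC submK.
Qed.

Lemma mpull_exp A k : mpull (upset_exp A k) = upset_exp (mpull A) k.
Proof. by elim: k => [//|k IHk]; rewrite /upset_exp /= -/(upset_exp _ k) mpull_add IHk. Qed.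

Section Surjective.
Hypothesis t_surj : forall j, exists v, t v = j.

(** Puts the whole exponent of [j] on the single variable [s j]. *)
Definition mlift (s : 'I_n -> 'I_N) a : 'X_{1..N} := (\sum_j U_(s j) *+ a j)%MM.

Lemma mpush_lift s a : cancel s t -> mpush (mlift s a) = a.
Proof.
move=> sK; rewrite {2}[a]multinomUE_id /mlift.
apply: (big_rec2 (fun m b => mpush m = b)); first exact: mpush0.
move=> j m b _ <-; rewrite mpushD; congr (_ + _)%MM.
elim: (a j) => [|k IHk]; first by rewrite !mulm0n mpush0.
by rewrite !mulmS mpushD IHk mpushU sK.
Qed.

Lemma mpull_support_meets F : mpull (support_meets F) = support_meets (t @^-1` F).
Proof.
apply/seteqP; split=> m [].
  move=> j Fj; rewrite mpushE => mj.
  have [v /eqP tv mv] : exists2 v, t v == j & (0 < m v)%N.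
    apply: contrapT => /forall2NP nv; move: mj; rewrite big1 // => v tv.
    by case: (nv v) => [//|/negP]; rewrite -leqNgt leqn0 => /eqP.
  by exists v => //=; rewrite tv.
by move=> v Fv mv; exists (t v) => //; apply: leq_trans (leq_mpush _ _).
Qed.

Lemma mpull_sub_support_meets A G :
  mpull A `<=` support_meets G -> A `<=` support_meets [set j | forall v, t v = j -> G v].
Proof.
move=> AG a Aa.
(* The section picks a variable outside [G] in every fibre not contained in [G]. The lift of [a]
   along it still meets [G], which forces the whole fibre over some [j] in the support of [a] into
   [G]. *)
have /choice[s sP] : forall j, exists v, t v = j /\ (G v -> forall v, t v = j -> G v).
  move=> j; have [jG|/existsNP[v /not_implyP[tv nGv]]] :=
    pselect (forall v, t v = j -> G v); last by exists v; split.
  by have [v tv] := t_surj j; exists v.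
have sK : cancel s t by move=> j; case: (sP j).
have [|v Gv] := AG (mlift s a); first by rewrite /mpull /= mpush_lift.
rewrite mnm_sumE => sv.
have [j] : exists j, (0 < (U_(s j) *+ a j)%MM v)%N.
  apply: contrapT => /forallNP nv; move: sv; rewrite big1 // => j _.
  by apply/eqP; rewrite -leqn0 leqNgt; apply/negP/nv.
rewrite mulmnE mnm1E; case: eqP => [svj|//]; rewrite mul1n => aj.
by exists j => //; apply: (sP j).2; rewrite svj.
Qed.

(** The blocks contained in a cover [G] already form a cover, so a minimal [G] is a union of blocks;
    surjectivity of [t] lets [F] be recovered from its preimage. *)
Lemma minimal_cover_mpull A :
  minimal_cover (mpull A) = [set t @^-1` F | F in minimal_cover A].
Proof.
have cov F : A `<=` support_meets F -> mpull A `<=` support_meets (t @^-1` F).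
  by move=> AF; rewrite -mpull_support_meets => m /AF.
apply/seteqP; split=> [G [AG Gmin]|_ [F [AF Fmin] <-]].
  pose F := [set j | forall v, t v = j -> G v].
  have AF : A `<=` support_meets F by apply: mpull_sub_support_meets.
  have FG : t @^-1` F = G by apply: Gmin; [exact: cov|move=> v /=; apply].
  exists F => //; split=> // F' AF' sF'.
  have e : t @^-1` F' = G by apply: Gmin; [exact: cov|move=> v /sF'; apply].
  apply/seteqP; split => // j Fj; have [v tv] := t_surj j.
  by have : G v by [apply: Fj]; rewrite -e /= tv.
split=> [|G AG sG]; first exact: cov.
have e : [set j | forall v, t v = j -> G v] = F.
  apply: Fmin; first exact: mpull_sub_support_meets.
  by move=> j jG; have [v tv] := t_surj j; rewrite -tv; apply/sG/jG.
by apply/seteqP; split=> // v /=; rewrite -e; apply.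
Qed.

Lemma mpull_localize A F : mpull (localize A F) = localize (mpull A) (t @^-1` F).
Proof.
apply/seteqP; split=> m [a Aa am]; last first.
  exists (mpush a) => // j Fj; rewrite !mpushE; apply: leq_sum => v /eqP tv.
  by apply: am => /=; rewrite tv.
have [s sK] : exists s, cancel s t by have /choice[s] := t_surj; exists s.
have [|m' /mnm_lepP m'm m'a] := @mpush_split (mrestr F a) m.
  by apply/mnm_lepP => j; rewrite mrestrE; case: asboolP => // /am.
have lE : mpush (mlift s (mrestr (~` F) a)) = mrestr (~` F) a by exact: mpush_lift.
(* The part of [a] on [F] is lifted below [m]; the part off [F] may be lifted anywhere, since it
   adds nothing to the variables over [F]. *)
exists (m' + mlift s (mrestr (~` F) a))%MM.
  rewrite /mpull /= mpushD m'a lE; suff -> : (mrestr F a + mrestr (~` F) a)%MM = a by [].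
  apply/mnmP => j; rewrite mnmDE !mrestrE.
  case: asboolP => Fj; case: asboolP => nFj; rewrite ?addn0 //.
move=> v Fv; rewrite mnmDE -[leqRHS]addn0 leq_add //.
apply: leq_trans (leq_mpush _ _) _; rewrite lE mrestrE.
by case: asboolP.
Qed.

Lemma symbolic_upset_mpull A k :
  symbolic_upset (mpull A) k = mpull (symbolic_upset A k).
Proof.
rewrite /symbolic_upset minimal_cover_mpull bigcap_image.
by apply/seteqP; split=> m Am F /Am; rewrite -mpull_exp -mpull_localize.
Qed.

End Surjective.
End Pushforward.

(** * Expansion as pullback along the map from variables to blocks *)

Section ExpansionOfUpSets.
Variables (K : fieldType) (n : nat) (i : 'I_n -> nat).
Implicit Types (A : set 'X_{1..n}) (a b : 'X_{1..n}).

Definition xblock (v : 'I_(nxvars i)) : 'I_n := tag (enum_val v).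

(** Positivity of the tuple enters here: no block is empty. *)
Lemma xblock_surj : (forall j, 0 < i j)%N -> forall j, exists v, xblock v = j.
Proof.
move=> i_gt0 j; exists (enum_rank (Tagged (fun j => 'I_(i j)) (Ordinal (i_gt0 j)))).
by rewrite /xblock enum_rankK.
Qed.

Definition above a : set 'X_{1..n} := [set m | (a <= m)%MM].

Lemma upset_above a : upset (above a).
Proof. by move=> b m; apply: lepm_trans. Qed.

Lemma above0 : above 0%MM = setT.
Proof. by apply/seteqP; split=> // m _; apply/mnm_lepP => j; rewrite mnm0E. Qed.

Lemma above_add a b : upset_add (above a) (above b) = above (a + b)%MM.
Proof.
apply/seteqP; split=> [_ [a' [b' [/mnm_lepP aa' /mnm_lepP bb' ->]]]|m abm].
  by apply/mnm_lepP => j; rewrite !mnmDE leq_add.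
exists a, (m - a)%MM; split; [exact: lepm_refl| |].
  apply/mnm_lepP => j; move/mnm_lepP/(_ j): abm; rewrite mnmDE mnmBE; lia.
by rewrite addmC submK //; apply: lepm_trans abm; apply: lem_addr.
Qed.

Lemma PidealE j : @Pideal K n i j = mideal K (mpull xblock (above U_(j)%MM)).
Proof.
have uA : upset (mpull xblock (above U_(j)%MM)) by apply: upset_mpull; apply: upset_above.
apply/seteqP; split.
  apply: smallest_sub; first exact: ideal_mideal.
  move=> _ [k _ <-]; apply/mideal_mpolyX.
  by rewrite /mpull /above /= mpushU /xblock enum_rankK lepm_refl.
apply: mideal_sub => [|m]; first exact: is_ideal_gen.
rewrite /mpull /above /= => /mpush_split[m' m'm m'j].
(* Pushing forward preserves the total degree, so a vector over a unit vector is itself a unit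
   vector. *)
have [v m'v] : exists v, m' = U_(v)%MM.
  have : mdeg m' = mdeg (mpush xblock m').
    rewrite !mdegE (partition_big xblock xpredT) //=.
    by apply: eq_bigr => j' _; rewrite mpushE.
  by rewrite m'j mdeg1 => /eqP/mdeg1P[v /eqP]; exists v.
have vj : xblock v = j.
  move: m'j; rewrite m'v mpushU => /mnmP/(_ j).
  by rewrite !mnm1E eqxx; case: eqP.
rewrite -(submK m'm) mpolyXD m'v; have [_ _ IM] := is_ideal_gen (range (@xvar K n i j)).
apply: IM; apply: sub_gen_smallest; move: vj.
rewrite -(enum_valK v) /xblock enum_rankK.
by case: (enum_val v) => [j' k] /= <-; exists k.
Qed.

(** The vector [a] is the sum of the multiples [U_(j) *+ a j], and sums of principal up-sets, hence
    of their pullbacks, correspond to products of ideals. *)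
Lemma PprodE a : Pprod K i a = mideal K (mpull xblock (above a)).
Proof.
have expE j k : ideal_exp (@Pideal K n i j) k
    = mideal K (mpull xblock (above (U_(j) *+ k)%MM)).
  elim: k => [|k IHk]; first by rewrite mulm0n above0; apply/seteqP.
  rewrite /ideal_exp /= -/(ideal_exp _ k) IHk PidealE mideal_mul ?mulmS.
    by rewrite -mpull_add above_add.
  by apply: upset_mpull; apply: upset_above.
rewrite /Pprod [in RHS](multinomUE_id a).
apply: (big_rec2 (fun J b => J = mideal K (mpull xblock (above b)))).
  by rewrite above0; apply/seteqP.
move=> j b J _ ->; rewrite expE mideal_mul -?mpull_add ?above_add //.
by apply: upset_mpull; apply: upset_above.
Qed.

Lemma expansion_genE (s : seq 'X_{1..n}) :
  expansion_gen K i s = mideal K (mpull xblock (up_closure s)).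
Proof.
apply/seteqP; split.
  apply: smallest_sub; first by apply: ideal_mideal; apply: upset_mpull; apply: upset_up_closure.
  by move=> f [a /= sa]; rewrite PprodE; apply: midealS => m am; exists a.
apply: mideal_sub => [|m [a sa am]]; first exact: is_ideal_gen.
by apply: sub_gen_smallest; exists a => //; rewrite PprodE; apply/mideal_mpolyX.
Qed.

Lemma expansion_mideal d A : upset A -> generated_below d A ->
  expansion i (mideal K A) = mideal K (mpull xblock A).
Proof.
move=> uA gA; rewrite (up_closure_mbox uA gA) mideal_up_closure expansionE.
exact: expansion_genE.
Qed.

End ExpansionOfUpSets.

Theorem corollary1p5 (K : fieldType) (n : nat) (i : 'I_n -> nat)
    (i_gt0 : forall j, (0 < i j)%N)
    (I : set {mpoly K[n]}) (monI : monomial_ideal I)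
    (k : nat) (k_gt0 : (1 <= k)%N) :
  expansion i (symbolic_power I k) = symbolic_power (expansion i I) k.
Proof.
have [s ->] := monI; rewrite -mideal_up_closure.
have uA := @upset_up_closure _ s; have [d gA] := generated_below_up_closure s.
rewrite (symbolic_power_mideal _ uA gA k_gt0) (expansion_mideal _ _ uA gA).
rewrite (symbolic_power_mideal _ (upset_mpull uA) (generated_below_mpull uA gA) k_gt0).
rewrite symbolic_upset_mpull; last exact: xblock_surj.
(* The bound [k * d] shows that the symbolic power is finitely generated by monomials, so its
   expansion is the pullback. *)
apply: expansion_mideal (generated_below_symbolic gA).
exact: upset_symbolic.
Qed.
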